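(* Suppose $A$ is a pointed type with a unique H-space structure which is left-invertible. Then any pointed map $f : A \to_* A$ is an H-space map, i.e., we have $f(a \cdot b) = f(a) \cdot f(b)$ for all $a, b : A$.
   Context: We work in homotopy type theory with a univalent universe. A (coherent) H-space structure on a pointed type $A$ with base point $\mathrm{pt}$ consists of an operation $\mu : A \to A \to A$, also written $a \cdot b$, unit laws $\mu_l : \mu(\mathrm{pt},-) = \mathrm{id}_A$ and $\mu_r : \mu(-,\mathrm{pt}) = \mathrm{id}_A$, and a coherence $\mu_l(\mathrm{pt}) = \mu_r(\mathrm{pt})$. $A$ has a unique H-space structure if the type $\mathrm{HSpace}(A)$ of all such structures is contractible. A structure is left-invertible if $a \cdot - : A \to A$ is an equivalence for all $a : A$. *)

(* Defs.v *)
(* Plain Rocq, no library.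

   The identity types of the theorem are those of homotopy type theory.  They
   cannot be Rocq's [eq]: it lives in [Prop], and univalence for it contradicts
   proof irrelevance, which Rocq is compatible with.  So we work in two-level type theory:
   Rocq is the outer, strict level, whose [=] is judgmental equality of the
   inner level, and homotopy type theory is the inner level, consisting of
   those Rocq types that carry a structure [Fib] ("fibrant types").  Fibrant
   types are closed under Rocq's own dependent products and sums, so that inner
   functions and pairs are Rocq functions and pairs; they have an identity type
   [Id] of their own, which eliminates into fibrant types only, and hence never
   into [=].

   Only the inner type formers that the theorem involves are required, so it
   holds whatever further inner types (natural numbers, higher inductive types,
   more universes) there are. *)

Set Implicit Arguments.
Unset Strict Implicit.
Unset Printing Implicit Defensive.

Class Fibrancy := {
  Fib : Type -> Type;
  fib_forall : forall (A : Type) (B : A -> Type),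
    Fib A -> (forall x, Fib (B x)) -> Fib (forall x, B x);
  fib_sigT : forall (A : Type) (B : A -> Type),
    Fib A -> (forall x, Fib (B x)) -> Fib {x : A & B x}
}.

Record FType {F : Fibrancy} := mkFType { carrier :> Type; fibrant : Fib carrier }.

Definition Pi {F : Fibrancy} (A : FType) (B : A -> FType) : FType :=
  mkFType (fib_forall (fibrant A) (fun x => fibrant (B x))).

Definition Sig {F : Fibrancy} (A : FType) (B : A -> FType) : FType :=
  mkFType (fib_sigT (fibrant A) (fun x => fibrant (B x))).

Definition Arr {F : Fibrancy} (A B : FType) : FType := Pi (fun _ : A => B).

Definition Prd {F : Fibrancy} (A B : FType) : FType := Sig (fun _ : A => B).

Class IdentityTypes {F : Fibrancy} := {
  Id : forall A : FType, A -> A -> FType;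
  refl : forall (A : FType) (a : A), Id a a;
  J : forall (A : FType) (a : A) (P : forall x : A, Id a x -> FType),
    P a (refl a) -> forall (x : A) (p : Id a x), P x p;
  J_refl : forall (A : FType) (a : A) (P : forall x : A, Id a x -> FType)
    (d : P a (refl a)), J d (refl a) = d
}.

Section HoTT.
Context {F : Fibrancy} {I : IdentityTypes}.

Definition isContr (A : FType) : FType :=
  Sig (fun c : A => Pi (fun x : A => Id c x)).

(* Equivalences are taken to be bi-invertible maps; this is a proposition, as
   opposed to having a two-sided inverse. *)
Definition isEquiv (A B : FType) (f : Arr A B) : FType :=
  Prd (Sig (fun g : Arr B A => Pi (fun y : B => Id (f (g y)) y)))
      (Sig (fun h : Arr B A => Pi (fun x : A => Id (h (f x)) x))).

Definition Equiv (A B : FType) : FType := Sig (fun f : Arr A B => isEquiv f).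

Definition idequiv (A : FType) : Equiv A A :=
  existT (fun f : A -> A => isEquiv (f : Arr A A)) (fun x => x)
    (existT (fun _ => _)
       (existT (fun g : A -> A => forall y : A, Id (g y) y)
          (fun y => y) (fun y => refl y))
       (existT (fun h : A -> A => forall x : A, Id (h x) x)
          (fun x => x) (fun x => refl x))).

Definition happly (A : FType) (B : A -> FType) (f g : Pi B) (p : Id f g)
  (x : A) : Id (f x) (g x) :=
  J (P := fun (h : Pi B) (_ : Id f h) => Id (f x) (h x)) (refl (f x)) p.

(* A universe a la Tarski.  The equations [El_*] are judgmental equalities of
   inner types, hence Rocq's [=] on [FType]. *)
Record Universe := {
  U : FType;
  El : U -> FType;
  code_pi : forall a : U, (El a -> U) -> U;
  El_pi : forall (a : U) (b : El a -> U),
    El (code_pi b) = Pi (fun x : El a => El (b x));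
  code_sig : forall a : U, (El a -> U) -> U;
  El_sig : forall (a : U) (b : El a -> U),
    El (code_sig b) = Sig (fun x : El a => El (b x));
  code_id : forall a : U, El a -> El a -> U;
  El_id : forall (a : U) (x y : El a), El (code_id x y) = Id x y
}.

Definition idtoequiv (V : Universe) (a b : U V) :
  Arr (Id a b) (Equiv (El a) (El b)) :=
  fun p => J (P := fun (c : U V) (_ : Id a c) => Equiv (El a) (El c))
             (idequiv (El a)) p.

Definition Univalence (V : Universe) : FType :=
  Pi (fun a : U V => Pi (fun b : U V => isEquiv (@idtoequiv V a b))).

(* [(mu, mu_l, mu_r, mu_lr)], where the unit laws are identifications of
   functions, and are applied to [pt] by [happly] in the coherence [mu_lr]. *)
Definition HSpace (A : FType) (pt : A) : FType :=
  Sig (fun mu : Arr A (Arr A A) =>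
  Sig (fun mu_l : Id (A := Arr A A) (mu pt) (fun b => b) =>
  Sig (fun mu_r : Id (A := Arr A A) (fun a => mu a pt) (fun a => a) =>
    Id (happly mu_l pt) (happly mu_r pt)))).

Definition hop (A : FType) (pt : A) (h : HSpace pt) : A -> A -> A := projT1 h.

Definition UniqueHSpace (A : FType) (pt : A) : FType := isContr (HSpace pt).

(* The H-space structure of a type that has a unique one: the centre of
   contraction. *)
Definition the_HSpace (A : FType) (pt : A) (u : UniqueHSpace pt) : HSpace pt :=
  projT1 u.

Definition LeftInvertible (A : FType) (pt : A) (h : HSpace pt) : FType :=
  Pi (fun a : A => isEquiv (hop h a : Arr A A)).

Definition PMap (A : FType) (ptA : A) (B : FType) (ptB : B) : FType :=
  Sig (fun f : Arr A B => Id (f ptA) ptB).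

Definition pmap_fun (A : FType) (ptA : A) (B : FType) (ptB : B)
  (f : PMap ptA ptB) : A -> B := projT1 f.

Definition IsHSpaceMap (A : FType) (ptA : A) (hA : HSpace ptA)
  (B : FType) (ptB : B) (hB : HSpace ptB) (f : PMap ptA ptB) : FType :=
  Pi (fun a : A => Pi (fun b : A =>
    Id (pmap_fun f (hop hA a b)) (hop hB (pmap_fun f a) (pmap_fun f b)))).

End HoTT.

(* Main.v *)
Require Import Defs.

(** Write [a * b] for the product of the unique H-space structure.  Left
    invertibility makes every equation [c * x = y] uniquely solvable for [x].
    Let [D a b] be the solution of [(f a * f b) * D a b = f (a * b)]: it is the
    defect of multiplicativity of [f], as [D a b = pt] exactly when
    [f (a * b) = f a * f b].  Since [f] is pointed, it does respect products in
    which one factor is [pt], so [D] vanishes as soon as one of its arguments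
    is [pt].  Hence twisting the product by the defect, [(a * b) * D a b],
    yields an operation that again satisfies both unit laws.  By uniqueness it
    is the given product, so [(a * b) * D a b = a * b = (a * b) * pt], and
    cancelling [a * b] gives [D a b = pt].

    Two points remain.  Uniqueness is about coherent structures, and the unit
    laws just obtained may fail to be coherent.  But on an H-space every loop at
    [pt] extends to a choice of a loop at each point ([spread_loop]), and this
    lets one correct the right unit law by the loop that measures the failure
    ([unital_operation_unique]).  Further, the unit laws of a structure are
    identifications of functions, so pointwise laws have to be converted by
    function extensionality, in a form that computes pointwise because the
    coherence depends on it.  It is derived from univalence ([funext_El]):
    composition with an equivalence between types of the universe is
    left-cancellable, and this is applied to the source map from the path space
    of the codomain. *)

Set Implicit Arguments.
Unset Strict Implicit.
Unset Printing Implicit Defensive.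

Section Proof.
Context {F : Fibrancy} {I : IdentityTypes}.

(** * Paths *)

Definition inv (A : FType) (x y : A) (p : Id x y) : Id y x :=
  J (P := fun z (_ : Id x z) => Id z x) (refl x) p.

Definition concat (A : FType) (x y z : A) (p : Id x y) : Id y z -> Id x z :=
  J (P := fun w (_ : Id x w) => Arr (Id w z) (Id x z)) (fun q => q) p.

Definition ap (A B : FType) (f : A -> B) (x y : A) (p : Id x y) :
  Id (f x) (f y) :=
  J (P := fun z (_ : Id x z) => Id (f x) (f z)) (refl (f x)) p.

Definition transport (A : FType) (P : A -> FType) (x y : A) (p : Id x y) :
  P x -> P y :=
  J (P := fun z (_ : Id x z) => Arr (P x) (P z)) (fun d => d) p.

Lemma inv_refl (A : FType) (x : A) : inv (refl x) = refl x.
Proof. exact (J_refl _). Qed.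

Lemma concat_refl_l (A : FType) (x z : A) (q : Id x z) :
  concat (refl x) q = q.
Proof. unfold concat; rewrite J_refl; reflexivity. Qed.

Lemma concat_p_Vp (A : FType) (x y z : A) (p : Id x y) (q : Id x z) :
  Id (concat p (concat (inv p) q)) q.
Proof.
  refine (J (P := fun w (p : Id x w) => Id (concat p (concat (inv p) q)) q) _ p).
  rewrite inv_refl, !concat_refl_l. apply refl.
Defined.

Lemma concat_V_of_path (A : FType) (x y : A) (p q : Id x y) (c : Id p q) :
  Id (concat (inv q) p) (refl y).
Proof.
  refine (J (P := fun q (_ : Id p q) => Id (concat (inv q) p) (refl y)) _ c).
  refine (J (P := fun y (p : Id x y) => Id (concat (inv p) p) (refl y)) _ p).
  rewrite inv_refl, concat_refl_l. apply refl.
Defined.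

Lemma isEquiv_cancel (A B : FType) (f : Arr A B) (e : isEquiv f) (x y : A) :
  Id (f x) (f y) -> Id x y.
Proof.
  destruct e as [_ [h hf]]. intro p.
  exact (concat (inv (hf x)) (concat (ap h p) (hf y))).
Defined.

(** * Function extensionality from univalence *)

Section Univalence.
Context (V : Universe) (univalence : Univalence V).

(** By univalence the equivalence may be taken to come from an identification
    of codes, and by path induction to be the identity.  The domain is only
    required to equal a decoded type, so that [T] may be a type of pairs whose
    projections compute. *)
Lemma postcompose_equiv_cancel (X T : FType) (c a : U V) (E : El c = T)
  (e : Equiv T (El a)) (K K' : Arr X T) :
  Id (A := Arr X (El a)) (fun x => projT1 e (K x)) (fun x => projT1 e (K' x)) ->
  Id K K'.
Proof.
  destruct E.
  pose (P := fun (b : U V) (e : Equiv (El c) (El b)) =>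
    Arr (Id (A := Arr X (El b)) (fun x => projT1 e (K x))
                                (fun x => projT1 e (K' x)))
        (Id K K')).
  assert (H : forall (b : U V) (p : Id c b), P b (idtoequiv p)).
  { intros b p.
    refine (J (P := fun (b : U V) (p : Id c b) => P b (idtoequiv p)) _ p).
    unfold idtoequiv; rewrite J_refl. exact (fun q => q). }
  destruct (univalence c a) as [[s hs] _].
  exact (transport (P := P a) (hs e) (H a (s e))).
Defined.

(** Only the outermost sum is decoded: [El (b x)] equals the intended fibre
    merely for each [x], which does not make the two families equal. *)
Lemma code_of_sum (d : U V) (X : FType) (E : El d = X) (b : X -> U V) :
  {c : U V & El c = Sig (fun x : X => El (b x))}.
Proof. destruct E. exists (code_sig b). apply El_sig. Defined.

Definition square (a : U V) : FType := Prd (El a) (El a).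

Definition path_code (a : U V) (t : square a) : U V :=
  code_id (projT1 t) (projT2 t).

(** The path space of [El a].  Its endpoints are not behind a decoding, so
    that both endpoint maps compute on explicit paths. *)
Definition path_space (a : U V) : FType :=
  Sig (fun t : square a => El (path_code t)).

Definition encode (a : U V) (x y : El a) (p : Id x y) : El (code_id x y) :=
  match eq_sym (El_id x y) in _ = T return carrier T with eq_refl => p end.

Definition decode (a : U V) (x y : El a) (q : El (code_id x y)) : Id x y :=
  match El_id x y in _ = T return carrier T with eq_refl => q end.

Lemma decode_encode (a : U V) (x y : El a) (p : Id x y) :
  decode (encode p) = p.
Proof.
  unfold decode, encode. revert p. destruct (El_id x y). reflexivity.
Qed.

Lemma encode_decode (a : U V) (x y : El a) (q : El (code_id x y)) :
  encode (decode q) = q.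
Proof. unfold decode, encode. destruct (El_id x y). reflexivity. Qed.

Definition mk_path (a : U V) (x y : El a) (p : Id x y) : path_space a :=
  existT (fun t : square a => El (path_code t))
    (existT (fun _ : El a => carrier (El a)) x y) (encode p).

Definition source (a : U V) : Arr (path_space a) (El a) :=
  fun t => projT1 (projT1 t).

Definition target (a : U V) : Arr (path_space a) (El a) :=
  fun t => projT2 (projT1 t).

Definition path_of (a : U V) (t : path_space a) : Id (source t) (target t) :=
  decode (projT2 t).

Lemma isEquiv_source (a : U V) : isEquiv (@source a).
Proof.
  split.
  - exists (fun x => mk_path (refl x)). exact (fun x => refl x).
  - exists (fun x => mk_path (refl x)). intros [[x y] q]; cbn in q.
    change (Id (mk_path (refl x))
      (existT (fun t : square a => El (path_code t))
        (existT (fun _ : El a => carrier (El a)) x y) q)).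
    rewrite <- (encode_decode q).
    exact (J (P := fun y (p : Id x y) => Id (mk_path (refl x)) (mk_path p))
             (refl _) (decode q)).
Defined.

Lemma path_space_code (a : U V) : {c : U V & El c = path_space a}.
Proof.
  exact (code_of_sum (El_sig (fun _ : El a => a)) (@path_code a)).
Defined.

(** A homotopy from [f] to [g] is a map into the path space with source [f];
    so is the constant homotopy at [f].  The two maps agree after composition
    with the equivalence [source], hence agree, and path induction reduces the
    claim to the constant homotopy. *)
Lemma funext_El (X : FType) (a : U V) (f g : Arr X (El a))
  (h : forall x, Id (f x) (g x)) :
  {p : Id f g & forall x, Id (happly p x) (h x)}.
Proof.
  pose (R := (fun x => mk_path (refl (f x))) : Arr X (path_space a)).
  pose (H := (fun x => mk_path (h x)) : Arr X (path_space a)).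
  pose (Goal := fun K : Arr X (path_space a) =>
    Sig (fun p : Id (A := Arr X (El a)) (fun x => source (K x))
                                       (fun x => target (K x)) =>
      Pi (fun x : X => Id (happly p x) (path_of (K x))))).
  assert (RH : Id R H).
  { destruct (path_space_code a) as [c E].
    apply (postcompose_equiv_cancel E
      (e := existT (fun s : Arr (path_space a) (El a) => carrier (isEquiv s))
              (@source a) (isEquiv_source a))).
    exact (refl (A := Arr X (El a)) f). }
  assert (GR : Goal R).
  { exists (refl (A := Arr X (El a)) f). intro x.
    change (path_of (R x)) with (decode (encode (refl (f x)))).
    rewrite decode_encode. unfold happly; rewrite J_refl. apply refl. }
  destruct (transport (P := Goal) RH GR) as [p hp].
  exists p. intro x. rewrite <- (decode_encode (h x)). exact (hp x).
Defined.

End Univalence.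

(** * H-spaces *)

Section HSpaces.
Context (A : FType) (pt : A).

Definition left_unit (h : HSpace pt) (b : A) : Id (hop h pt b) b :=
  happly (projT1 (projT2 h)) b.

Definition right_unit (h : HSpace pt) (a : A) : Id (hop h a pt) a :=
  happly (projT1 (projT2 (projT2 h))) a.

Definition unit_coherence (h : HSpace pt) :
  Id (left_unit h pt) (right_unit h pt) :=
  projT2 (projT2 (projT2 h)).

(** The path from [a] to [a * x] is [a] times [k], preceded by the right unit
    law; letting the end [x] of [k] vary allows induction on [k]. *)
Lemma spread_path (h : HSpace pt) (x : A) (k : Id pt x) :
  {Q : forall a, Id a (hop h a x) & Id (concat (Q pt) (left_unit h x)) k}.
Proof.
  refine (J (P := fun x (k : Id pt x) =>
    Sig (fun Q : Pi (fun a : A => Id a (hop h a x)) =>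
      Id (concat (Q pt) (left_unit h x)) k)) _ k).
  exists (fun a => inv (right_unit h a)).
  apply concat_V_of_path, unit_coherence.
Defined.

Lemma spread_loop (h : HSpace pt) (k : Id pt pt) :
  {q : forall a : A, Id a a & Id (q pt) k}.
Proof.
  destruct (spread_path h k) as [Q HQ].
  exists (fun a => concat (Q a) (right_unit h a)).
  refine (concat _ HQ).
  exact (ap (fun s => concat (Q pt) s) (inv (unit_coherence h))).
Defined.

(** The loop [k] by which the two unit laws of [m] differ at [pt] is spread over
    [A], and appended to the right unit law; this makes them coherent. *)
Lemma unital_operation_unique
  (funext : forall (f g : Arr A A) (h : forall x, Id (f x) (g x)),
    {p : Id f g & forall x, Id (happly p x) (h x)})
  (u : UniqueHSpace pt) (m : Arr A (Arr A A))
  (l : forall b, Id (m pt b) b) (r : forall a, Id (m a pt) a) (a b : A) :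
  Id (hop (the_HSpace u) a b) (m a b).
Proof.
  pose (k := concat (inv (r pt)) (l pt)).
  destruct (spread_loop (the_HSpace u) k) as [q hq].
  destruct (funext (m pt) (fun b => b) l) as [ml hl].
  destruct (funext (fun a => m a pt) (fun a => a)
    (fun a => concat (r a) (q a))) as [mr hr].
  assert (coh : Id (happly ml pt) (happly mr pt)).
  { refine (concat (hl pt) (concat (inv _) (inv (hr pt)))).
    refine (concat (ap (fun s => concat (r pt) s) hq) _).
    apply concat_p_Vp. }
  pose (s := existT _ m (existT _ ml (existT _ mr coh)) : HSpace pt).
  exact (happly (happly (ap (B := Arr A (Arr A A)) (fun t : HSpace pt => hop t)
    (projT2 u s)) a) b).
Defined.

End HSpaces.

(** * The defect of multiplicativity *)

Section Defect.
Context (A : FType) (pt : A) (h : HSpace pt) (linv : LeftInvertible h).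
Context (f : Arr A A).

Definition left_div (c y : A) : A := projT1 (projT1 (linv c)) y.

Definition mul_left_div (c y : A) : Id (hop h c (left_div c y)) y :=
  projT2 (projT1 (linv c)) y.

Definition defect (a b : A) : A :=
  left_div (hop h (f a) (f b)) (f (hop h a b)).

Lemma mul_eq_self (c d : A) : Id (hop h c d) c -> Id d pt.
Proof.
  intro p. apply (isEquiv_cancel (linv c)).
  exact (concat p (inv (right_unit h c))).
Defined.

Lemma defect_trivial (a b : A) :
  Id (f (hop h a b)) (hop h (f a) (f b)) -> Id (defect a b) pt.
Proof.
  intro p. apply (mul_eq_self (c := hop h (f a) (f b))).
  exact (concat (mul_left_div _ _) p).
Defined.

Lemma multiplicative_of_defect (a b : A) :
  Id (defect a b) pt -> Id (f (hop h a b)) (hop h (f a) (f b)).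
Proof.
  intro p. refine (concat (inv (mul_left_div (hop h (f a) (f b)) _)) _).
  exact (concat (ap (hop h _) p) (right_unit h _)).
Defined.

Lemma mul_defect_trivial (a b c : A) :
  Id (f (hop h a b)) (hop h (f a) (f b)) -> Id (hop h a b) c ->
  Id (hop h (hop h a b) (defect a b)) c.
Proof.
  intros p q. refine (concat _ q).
  exact (concat (ap (hop h _) (defect_trivial p)) (right_unit h _)).
Defined.

Context (f_pt : Id (f pt) pt).

Lemma multiplicative_pt_l (b : A) :
  Id (f (hop h pt b)) (hop h (f pt) (f b)).
Proof.
  refine (concat (ap f (left_unit h b)) (concat (inv (left_unit h (f b))) _)).
  exact (ap (fun c => hop h c (f b)) (inv f_pt)).
Defined.

Lemma multiplicative_pt_r (a : A) :
  Id (f (hop h a pt)) (hop h (f a) (f pt)).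
Proof.
  refine (concat (ap f (right_unit h a)) (concat (inv (right_unit h (f a))) _)).
  exact (ap (hop h (f a)) (inv f_pt)).
Defined.

End Defect.

End Proof.

Theorem proposition2p33 (F : Fibrancy) (I : IdentityTypes) (V : Universe)
  (univalence : Univalence V)
  (A : U V) (pt : El A)
  (u : UniqueHSpace pt) (linv : LeftInvertible (the_HSpace u))
  (f : PMap pt pt) :
  IsHSpaceMap (the_HSpace u) (the_HSpace u) f.
Proof.
  intros a b. destruct f as [f f_pt]. unfold pmap_fun; cbn [projT1].
  apply (multiplicative_of_defect (linv := linv)).
  apply (mul_eq_self linv (c := hop (the_HSpace u) a b)), inv.
  apply (unital_operation_unique (funext_El univalence (X := El A) (a := A)) u
    (m := fun a b => hop (the_HSpace u) (hop (the_HSpace u) a b)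
                         (defect linv f a b))).
  - intro y. apply mul_defect_trivial.
    + exact (multiplicative_pt_l (the_HSpace u) f_pt y).
    + apply left_unit.
  - intro x. apply mul_defect_trivial.
    + exact (multiplicative_pt_r (the_HSpace u) f_pt x).
    + apply right_unit.
Qed.
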